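(* Let $A$ be a transitional ring with transition map $\psi:A\to\mathcal{P}(\Lambda)$, let $S=\{a\in A\mid\psi(a)=\emptyset\}$ and $A_S=S^{-1}A$. Then $A_S$ is also a transitional ring.
   Context: All rings are commutative with unity. $\mathcal{P}(\Lambda)$ is the power set of $\Lambda$. For a ring $A$ and a nonempty set $\Lambda$, a map $\psi:A\to\mathcal{P}(\Lambda)$ is a semi-transition map on $A$ if: (i) $\psi(ab)=\psi(a)\cup\psi(b)$ for all $a,b\in A$; (ii) $\psi(1)=\emptyset$, and $\psi(a)=\Lambda$ if and only if $a=0$; (iii) for all $a,b\in A$ there is some $c$ in the ideal $(a,b)$ with $\psi(a)\cap\psi(b)=\psi(c)\subseteq\psi(a+b)$; moreover, if $\psi(a)\cap\psi(b)=\emptyset$, then the ideal $(a^m,b^n)$ is principal for some $m,n\in\mathbb{N}$ (positive integers). The set $S$ is multiplicatively closed. A pm-ring is a ring in which each prime ideal is contained in a unique maximal ideal. A transition map on $A$ is a semi-transition map $\psi:A\to\mathcal{P}(\Lambda)$, where $A$ is a pm-ring, such that: (T1) if $\lambda_1\neq\lambda_2$ in $\Lambda$, then there is $a\in A$ such that $\psi(a)$ contains exactly one of $\lambda_1,\lambda_2$; (T2) for all $\lambda\in\Lambda$ and $a\in A$ with $\lambda\notin\psi(a)$, there is $b\in A$ with $\lambda\in\psi(b)$ and $\psi(a)\cap\psi(b)=\emptyset$. A ring is transitional if it is a pm-ring admitting a transition map. *)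

(* Defs.v *)
From HB Require Import structures.
From mathcomp Require Import all_boot all_algebra.
From mathcomp Require Import boolp classical_sets.
From mathcomp Require Import ring.

Set Implicit Arguments.
Unset Strict Implicit.
Unset Printing Implicit Defensive.

Import GRing.Theory.

Local Open Scope classical_set_scope.
Local Open Scope ring_scope.
Local Open Scope quotient_scope.

(* The ideals of [ring_quotient] are boolean and live over nontrivial rings
   only; here they are arbitrary subsets, and the zero ring is allowed. *)
Section Ideals.
Variable A : comPzRingType.

Record ideal (I : set A) : Prop := Ideal {
  ideal0 : I 0;
  idealD : forall a b, I a -> I b -> I (a + b);
  idealMl : forall r a, I a -> I (r * a) }.

Record prime_ideal (P : set A) : Prop := PrimeIdeal {
  prime_is_ideal : ideal P;
  prime_proper : P != [set: A];
  primeM : forall a b, P (a * b) -> P a \/ P b }.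

Record maximal_ideal (M : set A) : Prop := MaximalIdeal {
  maximal_is_ideal : ideal M;
  maximal_proper : M != [set: A];
  maximalP : forall I, ideal I -> M `<=` I -> I = M \/ I = [set: A] }.

Definition ideal_gen1 (d : A) : set A := [set x | exists u, x = u * d].

Definition ideal_gen2 (a b : A) : set A :=
  [set x | exists u v, x = u * a + v * b].

Definition principal (I : set A) : Prop := exists d, I = ideal_gen1 d.

End Ideals.

Definition pm_ring (A : comPzRingType) : Prop :=
  forall P : set A, prime_ideal P ->
    exists! M : set A, maximal_ideal M /\ P `<=` M.

Record semi_transition (A : comPzRingType) (Lambda : Type)
    (psi : A -> set Lambda) : Prop := SemiTransition {
  semi_transition_nonempty : [set: Lambda] !=set0;
  semi_transitionM : forall a b, psi (a * b) = psi a `|` psi b;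
  semi_transition1 : psi 1 = set0;
  semi_transitionT : forall a, psi a = [set: Lambda] <-> a = 0;
  semi_transitionI : forall a b, exists c,
    [/\ ideal_gen2 a b c, psi a `&` psi b = psi c & psi c `<=` psi (a + b)];
  semi_transition_principal : forall a b, psi a `&` psi b = set0 ->
    exists m n : nat,
      [/\ (0 < m)%N, (0 < n)%N & principal (ideal_gen2 (a ^+ m) (b ^+ n))] }.

Record transition (A : comPzRingType) (Lambda : Type)
    (psi : A -> set Lambda) : Prop := Transition {
  transition_pm : pm_ring A;
  transition_semi : semi_transition psi;
  transition_separates : forall l1 l2 : Lambda, l1 <> l2 ->
    exists a, (psi a l1 /\ ~ psi a l2) \/ (~ psi a l1 /\ psi a l2);
  transition_regular : forall (l : Lambda) (a : A), ~ psi a l ->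
    exists b, psi b l /\ psi a `&` psi b = set0 }.

Definition transitional (A : comPzRingType) : Prop :=
  pm_ring A /\ exists (Lambda : Type) (psi : A -> set Lambda), transition psi.

Section EmptyLocus.
Variables (A : comPzRingType) (Lambda : Type) (psi : A -> set Lambda).

Definition empty_locus : {pred A} := fun a => `[< psi a = set0 >].

Hypothesis hpsi : semi_transition psi.

Lemma empty_locus_mulr_closed : mulr_closed empty_locus.
Proof.
split=> [|a b]; first by apply/asboolP; exact: semi_transition1 hpsi.
move=> /asboolP a0 /asboolP b0; apply/asboolP.
by rewrite (semi_transitionM hpsi) a0 b0 setU0.
Qed.

Definition empty_locus_mulrClosed : mulrClosed A :=
  HB.pack_for (mulrClosed A) (empty_locus : A -> bool)
    (GRing.isMulClosed.Build A empty_locus empty_locus_mulr_closed).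

End EmptyLocus.

(* The ring of fractions S^-1 A: pairs (a, s) with s in S, modulo
   (a, s) ~ (b, t) iff u * (a * t - b * s) = 0 for some u in S. *)
Module Localization.
Section Localization.
Variables (A : comPzRingType) (S : mulrClosed A).

Record pre := Pre { frac :> A * A; denP : frac.2 \in S }.

HB.instance Definition _ := [isSub for frac].
HB.instance Definition _ := [Choice of pre by <:].

Implicit Types x y z : pre.

Definition equiv x y : bool :=
  `[< exists2 u, u \in S & u * (x.1 * y.2 - y.1 * x.2) = 0 >].

Lemma equivP x y :
  reflect (exists2 u, u \in S & u * (x.1 * y.2 - y.1 * x.2) = 0) (equiv x y).
Proof. exact: asboolP. Qed.

Lemma equiv_refl : reflexive equiv.
Proof.
by move=> x; apply/equivP; exists 1; rewrite ?rpred1 // subrr mulr0.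
Qed.

Lemma equiv_sym : symmetric equiv.
Proof.
by move=> x y; apply/equivP/equivP => -[u uS e]; exists u => //;
  rewrite -opprB mulrN e oppr0.
Qed.

Lemma equiv_trans : transitive equiv.
Proof.
move=> y x z /equivP[u uS e] /equivP[v vS f]; apply/equivP.
exists (u * v * y.2); first by rewrite !rpredM // denP.
have -> : u * v * y.2 * (x.1 * z.2 - z.1 * x.2) =
    v * z.2 * (u * (x.1 * y.2 - y.1 * x.2))
    + u * x.2 * (v * (y.1 * z.2 - z.1 * y.2)) by ring.
by rewrite e f !mulr0 addr0.
Qed.

Canonical equiv_equiv := EquivRel equiv equiv_refl equiv_sym equiv_trans.

Definition type := {eq_quot equiv}.

HB.instance Definition _ : EqQuotient _ equiv type := EqQuotient.on type.
HB.instance Definition _ := Choice.on type.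

Lemma repr_equiv x : equiv (repr (\pi_type x)) x.
Proof. by rewrite -eqmodE reprK. Qed.

Definition pre_embed (a : A) : pre := @Pre (a, 1) (rpred1 S).
Definition embed : A -> type := lift_embed type pre_embed.
Canonical embed_pi_morph := PiEmbed embed.

Definition pre_add x y : pre :=
  @Pre (x.1 * y.2 + y.1 * x.2, x.2 * y.2) (rpredM (denP x) (denP y)).
Definition add := lift_op2 type pre_add.

Lemma pi_add : {morph \pi : x y / pre_add x y >-> add x y}.
Proof.
move=> x y; unlock add; apply/eqmodP/equivP.
have /equivP[u uS e] := repr_equiv x; have /equivP[v vS f] := repr_equiv y.
exists (u * v) => /=; first exact: rpredM.
set x' := repr _ in e *; set y' := repr _ in f *.
transitivity (- (v * y.2 * y'.2 * (u * (x'.1 * x.2 - x.1 * x'.2)))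
  - u * x.2 * x'.2 * (v * (y'.1 * y.2 - y.1 * y'.2))); first by ring.
by rewrite e f !mulr0 oppr0 addr0.
Qed.
Canonical pi_add_morph := PiMorph2 pi_add.

Definition pre_opp x : pre := @Pre (- x.1, x.2) (denP x).
Definition opp := lift_op1 type pre_opp.

Lemma pi_opp : {morph \pi : x / pre_opp x >-> opp x}.
Proof.
move=> x; unlock opp; apply/eqmodP/equivP.
have /equivP[u uS e] := repr_equiv x; exists u => //=.
by rewrite -[RHS]e; ring.
Qed.
Canonical pi_opp_morph := PiMorph1 pi_opp.

Definition pre_mul x y : pre :=
  @Pre (x.1 * y.1, x.2 * y.2) (rpredM (denP x) (denP y)).
Definition mul := lift_op2 type pre_mul.

Lemma pi_mul : {morph \pi : x y / pre_mul x y >-> mul x y}.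
Proof.
move=> x y; unlock mul; apply/eqmodP/equivP.
have /equivP[u uS e] := repr_equiv x; have /equivP[v vS f] := repr_equiv y.
exists (u * v) => /=; first exact: rpredM.
set x' := repr _ in e *; set y' := repr _ in f *.
transitivity (- (v * y.1 * y'.2 * (u * (x'.1 * x.2 - x.1 * x'.2)))
  - u * x.2 * x'.1 * (v * (y'.1 * y.2 - y.1 * y'.2))); first by ring.
by rewrite e f !mulr0 oppr0 addr0.
Qed.
Canonical pi_mul_morph := PiMorph2 pi_mul.

Lemma pi_eq x y : x.1 * y.2 = y.1 * x.2 -> \pi_type x = \pi_type y.
Proof.
move=> e; apply/eqmodP/equivP; exists 1; first exact: rpred1.
by rewrite e subrr mulr0.
Qed.

Fact addA : associative add.
Proof.
elim/quotW=> x; elim/quotW=> y; elim/quotW=> z; rewrite !piE.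
by apply: pi_eq => /=; ring.
Qed.

Fact addC : commutative add.
Proof.
by elim/quotW=> x; elim/quotW=> y; rewrite !piE; apply: pi_eq => /=; ring.
Qed.

Fact add0 : left_id (embed 0) add.
Proof. by elim/quotW=> x; rewrite !piE; apply: pi_eq => /=; ring. Qed.

Fact addN : left_inverse (embed 0) opp add.
Proof. by elim/quotW=> x; rewrite !piE; apply: pi_eq => /=; ring. Qed.

HB.instance Definition _ := GRing.isZmodule.Build type addA addC add0 addN.

Fact mulA : associative mul.
Proof.
elim/quotW=> x; elim/quotW=> y; elim/quotW=> z; rewrite !piE.
by apply: pi_eq => /=; ring.
Qed.

Fact mulC : commutative mul.
Proof.
by elim/quotW=> x; elim/quotW=> y; rewrite !piE; apply: pi_eq => /=; ring.
Qed.

Fact mul1 : left_id (embed 1) mul.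
Proof. by elim/quotW=> x; rewrite !piE; apply: pi_eq => /=; ring. Qed.

Fact mulDl : left_distributive mul add.
Proof.
elim/quotW=> x; elim/quotW=> y; elim/quotW=> z; rewrite !piE.
by apply: pi_eq => /=; ring.
Qed.

HB.instance Definition _ :=
  GRing.Zmodule_isComPzRing.Build type mulA mulC mul1 mulDl.

Fact embed_is_zmod_morphism : zmod_morphism embed.
Proof.
move=> a b; rewrite -[RHS]/(add _ (opp _)) !piE.
by apply: pi_eq => /=; ring.
Qed.

Fact embed_is_monoid_morphism : monoid_morphism embed.
Proof.
split=> [//|a b]; rewrite -[RHS]/(mul _ _) !piE.
by apply: pi_eq => /=; ring.
Qed.

HB.instance Definition _ :=
  GRing.isZmodMorphism.Build A type embed embed_is_zmod_morphism.
HB.instance Definition _ :=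
  GRing.isMonoidMorphism.Build A type embed embed_is_monoid_morphism.

Lemma embed_inv s : s \in S -> exists y : type, embed s * y = 1.
Proof.
move=> sS; exists (\pi_type (@Pre (1, s) sS)).
rewrite -[LHS]/(mul _ _) -[RHS]/(embed 1) !piE.
by apply: pi_eq => /=; ring.
Qed.

Lemma embed_frac (y : type) : exists a s, s \in S /\ embed s * y = embed a.
Proof.
elim/quotW: y => x; exists x.1, x.2; split; first exact: denP.
by rewrite -[LHS]/(mul _ _) !piE; apply: pi_eq => /=; ring.
Qed.

Lemma embed_eq0 a : embed a = 0 <-> exists2 u, u \in S & u * a = 0.
Proof.
rewrite -[0 in X in X <-> _]/(embed 0) !piE; split.
  by move/eqmodP/equivP => [u uS /=]; rewrite mul0r subr0 mulr1; exists u.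
move=> [u uS e]; apply/eqmodP/equivP; exists u => //=.
by rewrite mul0r subr0 mulr1.
Qed.

End Localization.
End Localization.
HB.export Localization.

Notation localization := Localization.type.

(* Main.v *)
Require Import Defs.
From mathcomp Require Import all_boot all_algebra.
From mathcomp Require Import boolp classical_sets.
From mathcomp Require Import ring.

(** Elements of S are nonzerodivisors, so A embeds in [A_S], and psi extends to
    [A_S] by phi(a/s) = psi(a); the axioms pass from psi to phi, the principality
    clause because an ideal containing an element with empty phi is the unit ideal.

    To see that [A_S] is a pm-ring, suppose that a prime P lies in two distinct
    maximal ideals M1 and M2. Clearing denominators in a comaximality relation
    gives a in M1 and b in M2, both from A, with disjoint psi(a) and psi(b), so
    some ideal (a^m, b^n) = (d) of A is principal. Here d is in S, hence
    cancellable: writing a^m = a'd and b^n = b'd, one gets 1 in (a', b'). With Q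
    the contraction of P to A, both Q + (a') and Q + (b') are proper, since in
    [A_S] the elements a' and b' are still in M1 and M2. So Q lies in a maximal
    ideal containing a' and in another one containing b', against A being a
    pm-ring. *)

Set Implicit Arguments.
Unset Strict Implicit.
Unset Printing Implicit Defensive.

Import GRing.Theory.

Local Open Scope classical_set_scope.
Local Open Scope ring_scope.

(** * Maximal ideals, comaximality and the pm condition *)

Section IdealTheory.
Variable A : comPzRingType.
Implicit Types (I M : set A) (x y : A).

Lemma ideal_proper1 I : ideal I -> I != [set: A] -> ~ I 1.
Proof.
move=> idI /eqP In1 I1; apply: In1; rewrite -subTset => x _.
by rewrite -[x]mulr1; apply: idealMl.
Qed.

Definition adjoin I x : set A := [set y | exists i r, I i /\ y = i + r * x].

Lemma ideal_adjoin I x : ideal I -> ideal (adjoin I x).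
Proof.
move=> idI; split.
- by exists 0, 0; split; [exact: ideal0 | ring].
- move=> _ _ [i [r [Ii ->]]] [j [s [Ij ->]]].
  by exists (i + j), (r + s); split; [exact: idealD | ring].
- move=> t _ [i [r [Ii ->]]].
  by exists (t * i), (t * r); split; [exact: idealMl | ring].
Qed.

Lemma sub_adjoin I x : I `<=` adjoin I x.
Proof. by move=> i Ii; exists i, 0; split=> //; ring. Qed.

Lemma mem_adjoin I x : ideal I -> adjoin I x x.
Proof. by move=> idI; exists 0, 1; split; [exact: ideal0 | ring]. Qed.

Lemma ideal_sub_maximal I : ideal I -> ~ I 1 ->
  exists M, maximal_ideal M /\ I `<=` M.
Proof.
move=> idI I1.
(* The union with I makes the empty chain admissible. *)
pose P (X : set A) := ideal (I `|` X) /\ ~ (I `|` X) 1.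
have [|M [[idM M1] Mmax]] := @Zorn_bigcup A P.
  move=> F FP Ftot; set U := \bigcup_(X in F) X.
  have inU X : F X -> I `|` X `<=` I `|` U.
    by move=> FX z [Iz|Xz]; [left | right; exists X].
  (* As [F] is a chain, two elements of the union share a member; the case of both in [I] stands
     apart because [F] may be empty. *)
  have two a b : (I `|` U) a -> (I `|` U) b -> (I a /\ I b) \/
      exists2 X, F X & (I `|` X) a /\ (I `|` X) b.
    move=> [Ia|[X FX Xa]] [Ib|[Y FY Yb]]; first by left.
    - by right; exists Y => //; split; [left | right].
    - by right; exists X => //; split; [right | left].
    - have [XY|YX] := Ftot X Y FX FY.
        by right; exists Y => //; split; right=> //; exact: XY.
      by right; exists X => //; split; right=> //; exact: YX.
  split; first split.
  - by left; exact: ideal0.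
  - move=> a b /two h /h[[Ia Ib]|[X FX [Xa Xb]]]; first by left; exact: idealD.
    by apply: (inU X FX); apply: idealD => //; have [] := FP X FX.
  - move=> r a Ua; have [[Ia _]|[X FX [Xa _]]] := two a a Ua Ua.
      by left; exact: idealMl.
    by apply: (inU X FX); apply: idealMl => //; have [] := FP X FX.
  - by move=> [//|[X FX X1]]; have [_] := FP X FX; apply; right.
exists (I `|` M); split; last by move=> x; left.
split=> //; first by apply/eqP=> e; apply: M1; rewrite e.
move=> J idJ MJ; have [J1|J1] := pselect (J 1).
  by right; rewrite -subTset => x _; rewrite -[x]mulr1; exact: idealMl.
(* A point of [J] outside [I] and [M] would make [J] a strictly larger candidate than [M] in the
   Zorn order. *)
left; apply/seteqP; split=> // x Jx; apply: contrapT => Mx.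
have IJ : I `|` J = J by apply: setUidr => z Iz; apply: MJ; left.
apply: (Mmax J); last by split; rewrite IJ.
split=> [z Mz|JM]; first by apply: MJ; right.
by apply: Mx; right; exact: JM.
Qed.

(** For [x] in [M] but not in [N], maximality of [N] forces [adjoin N x] to be the whole ring. *)
Lemma maximal_comaximal M N : maximal_ideal M -> maximal_ideal N -> M <> N ->
  exists x y, [/\ M x, N y & x + y = 1].
Proof.
move=> maxM maxN MN.
have [x Mx Nx] : exists2 x, M x & ~ N x.
  apply: contrapT => h.
  have sMN : M `<=` N.
    by move=> x Mx; apply: contrapT => Nx; apply: h; exists x.
  have [e|e] := maximalP maxM (maximal_is_ideal maxN) sMN.
    exact/MN/esym.
  by have := maximal_proper maxN; rewrite e eqxx.
have idN := maximal_is_ideal maxN.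
have [e|e] := maximalP maxN (ideal_adjoin x idN) (@sub_adjoin N x).
  by exfalso; apply: Nx; rewrite -e; exact: mem_adjoin.
have [y [r [Ny e1]]] : adjoin N x 1 by rewrite e.
exists (r * x), y; split=> //; last by rewrite e1 addrC.
by apply: idealMl => //; exact: maximal_is_ideal.
Qed.

(** Otherwise both adjunctions lie in maximal ideals over [I]; these coincide by uniqueness, and the
    common one contains [x] and [y], hence 1. *)
Lemma pm_ring_comaximal I x y : pm_ring A -> prime_ideal I ->
  (exists u v, u * x + v * y = 1) -> adjoin I x 1 \/ adjoin I y 1.
Proof.
move=> pmA prI [u [v uv1]]; apply: contrapT => /not_orP[nx ny].
have idI := prime_is_ideal prI.
have [M [maxM sM]] := ideal_sub_maximal (ideal_adjoin x idI) nx.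
have [N [maxN sN]] := ideal_sub_maximal (ideal_adjoin y idI) ny.
have [L [_ uniqL]] := pmA I prI.
have LM : L = M by apply: uniqL; split=> // z Iz; exact/sM/sub_adjoin.
have LN : L = N by apply: uniqL; split=> // z Iz; exact/sN/sub_adjoin.
have idM := maximal_is_ideal maxM.
apply: (ideal_proper1 idM (maximal_proper maxM)); rewrite -uv1.
apply: idealD => //; apply: idealMl => //; first exact/sM/mem_adjoin.
by rewrite -LM LN; exact/sN/mem_adjoin.
Qed.

End IdealTheory.

Lemma prime_preimage (A B : comPzRingType) (f : {rmorphism A -> B})
  (P : set B) : prime_ideal P -> prime_ideal (f @^-1` P).
Proof.
move=> [idP Pn PM]; split.
- split=> /= [|a b Pa Pb|r a Pa]; rewrite ?rmorph0 ?rmorphD ?rmorphM.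
  + exact: ideal0.
  + exact: idealD.
  + exact: idealMl.
- apply/eqP=> e; apply: (ideal_proper1 idP Pn).
  by rewrite -(rmorph1 f) -[P _]/((f @^-1` P) 1) e.
- by move=> a b /=; rewrite rmorphM; exact: PM.
Qed.

(** * Elements with empty locus in the base ring *)

Section SemiTransitionTheory.
Variables (A : comPzRingType) (Lambda : Type) (psi : A -> set Lambda).
Hypothesis hpsi : semi_transition psi.

Lemma semi_transition_subD a b : psi a `&` psi b `<=` psi (a + b).
Proof. by have [c [_ -> ]] := semi_transitionI hpsi a b. Qed.

Lemma semi_transitionMl u a : psi u = set0 -> psi (u * a) = psi a.
Proof. by move=> u0; rewrite (semi_transitionM hpsi) u0 set0U. Qed.

Lemma semi_transitionMr a u : psi u = set0 -> psi (a * u) = psi a.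
Proof. by move=> u0; rewrite mulrC semi_transitionMl. Qed.

Lemma semi_transitionX a n : psi (a ^+ n) `<=` psi a.
Proof.
elim: n => [|n IHn]; first by rewrite expr0 (semi_transition1 hpsi); exact: sub0set.
by rewrite exprS (semi_transitionM hpsi) subUset; split.
Qed.

(** Multiplying by [u] leaves the locus unchanged, so [a] has the full locus of 0. *)
Lemma empty_locus_reg u a : psi u = set0 -> u * a = 0 -> a = 0.
Proof.
move=> u0 ua0; apply/(semi_transitionT hpsi).
by rewrite -(semi_transitionMl a u0) ua0; exact/(semi_transitionT hpsi).
Qed.

(** The generator [d] divides both powers, so its locus lies in those of [a] and [b] and is empty;
    [d] can then be cancelled from its own expression in the two powers. *)
Lemma comaximal_cofactors a b : psi a `&` psi b = set0 ->
  exists m n a' b' d, [/\ (0 < m)%N, (0 < n)%N, psi d = set0,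
    a ^+ m = a' * d /\ b ^+ n = b' * d & exists u v, u * a' + v * b' = 1].
Proof.
move=> ab0.
have [m [n [m0 n0 [d dE]]]] := semi_transition_principal hpsi ab0.
have [a' aE] : ideal_gen1 d (a ^+ m) by rewrite -dE; exists 1, 0; ring.
have [b' bE] : ideal_gen1 d (b ^+ n) by rewrite -dE; exists 0, 1; ring.
have [u [v uv]] : ideal_gen2 (a ^+ m) (b ^+ n) d.
  by rewrite dE; exists 1; ring.
have d0 : psi d = set0.
  rewrite -subset0 -ab0 subsetI; split.
    by apply: subset_trans (@semi_transitionX a m); rewrite aE (semi_transitionM hpsi).
  by apply: subset_trans (@semi_transitionX b n); rewrite bE (semi_transitionM hpsi).
exists m, n, a', b', d; split=> //; exists u, v.
apply/subr0_eq/(empty_locus_reg d0).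
transitivity (u * (a' * d) + v * (b' * d) - d); first by ring.
by rewrite -aE -bE -uv subrr.
Qed.

End SemiTransitionTheory.

(** * The extended map on the ring of fractions *)

Section Fractions.
Variables (A : comPzRingType) (Lambda : Type) (psi : A -> set Lambda).
Hypothesis hpsi : semi_transition psi.

Notation S := (empty_locus_mulrClosed hpsi).
Notation AS := (localization S).
Notation iota := (@embed A S).

Lemma empty_locusE s : (s \in S) <-> psi s = set0.
Proof. by split=> /asboolP. Qed.

Lemma embed_inj : injective iota.
Proof.
move=> a b /eqP; rewrite -subr_eq0 -rmorphB => /eqP/embed_eq0[u /empty_locusE u0].
by move/(empty_locus_reg hpsi u0)/subr0_eq.
Qed.

Lemma embed_unit s : psi s = set0 -> exists y, y * iota s = 1.
Proof. by move=> /empty_locusE /embed_inv[y]; exists y; rewrite mulrC. Qed.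

Lemma embed_fracP (y : AS) : exists a s, psi s = set0 /\ iota s * y = iota a.
Proof. by have [a [s [/empty_locusE]]] := embed_frac y; exists a, s. Qed.

(** This is the map phi; ranging over all representations of [y] as a fraction avoids choosing
    one. *)
Definition frac_locus (y : AS) : set Lambda :=
  [set l | exists a s, [/\ psi s = set0, iota s * y = iota a & psi a l]].

(** Cross-multiplying two representations gives an equality in [A] by injectivity, and the
    denominators do not affect loci. *)
Lemma frac_locusE y a s : psi s = set0 -> iota s * y = iota a ->
  frac_locus y = psi a.
Proof.
move=> s0 e; apply/seteqP; split=> l; last by exists a, s.
move=> [b [t [t0 f bl]]].
have /embed_inj st : iota (s * b) = iota (t * a).
  by rewrite !rmorphM /= -e -f mulrCA.
by rewrite -(semi_transitionMl hpsi a t0) -st (semi_transitionMl hpsi).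
Qed.

Lemma frac_locus_embed a : frac_locus (iota a) = psi a.
Proof.
by apply: (@frac_locusE _ _ 1); rewrite ?rmorph1 ?mul1r // (semi_transition1 hpsi).
Qed.

Lemma frac_semi_transition : semi_transition frac_locus.
Proof.
split.
- exact: semi_transition_nonempty hpsi.
- move=> x y; have [a [s [s0 sx]]] := embed_fracP x.
  have [b [t [t0 ty]]] := embed_fracP y.
  rewrite (frac_locusE s0 sx) (frac_locusE t0 ty) -(semi_transitionM hpsi).
  apply: (@frac_locusE _ _ (s * t)); first by rewrite (semi_transitionMl hpsi).
  by rewrite !rmorphM /= -sx -ty; ring.
- by rewrite -[1](rmorph1 iota) frac_locus_embed (semi_transition1 hpsi).
- move=> x; have [a [s [s0 sx]]] := embed_fracP x.
  rewrite (frac_locusE s0 sx); split=> [/(semi_transitionT hpsi) a0|x0].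
    have [z zs] := embed_unit s0.
    by rewrite -[x]mul1r -zs -mulrA sx a0 rmorph0 mulr0.
  apply/(semi_transitionT hpsi); apply: embed_inj.
  by rewrite -sx x0 mulr0 rmorph0.
- move=> x y; have [a [s [s0 sx]]] := embed_fracP x.
  have [b [t [t0 ty]]] := embed_fracP y.
  (* These are the numerators of [x] and [y] over the common denominator [s * t]. *)
  have [c [[u [v cE]] abc cab]] := semi_transitionI hpsi (t * a) (s * b).
  exists (iota c); rewrite frac_locus_embed; split.
  + exists (iota (u * t * s)), (iota (v * s * t)).
    by rewrite cE !(rmorphD, rmorphM) /= -sx -ty; ring.
  + by rewrite (frac_locusE s0 sx) (frac_locusE t0 ty) -abc !(semi_transitionMl hpsi).
  + rewrite (@frac_locusE (x + y) (t * a + s * b) (s * t)) //.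
      by rewrite (semi_transitionMl hpsi).
    by rewrite !(rmorphD, rmorphM) /= -sx -ty; ring.
- move=> x y; have [a [s [s0 sx]]] := embed_fracP x.
  have [b [t [t0 ty]]] := embed_fracP y.
  rewrite (frac_locusE s0 sx) (frac_locusE t0 ty) => ab0.
  (* Here [c] has empty locus, so it becomes a unit and [x], [y] generate the unit ideal: exponents
     1 suffice. *)
  have [c [[u [v cE]] abc _]] := semi_transitionI hpsi a b.
  have [z zc] : exists z, z * iota c = 1 by apply: embed_unit; rewrite -abc.
  exists 1, 1; split=> //; exists 1; rewrite !expr1.
  apply/seteqP; split=> w _; first by exists w; rewrite mulr1.
  exists (w * z * iota u * iota s), (w * z * iota v * iota t).
  rewrite -[LHS]mulr1 -zc cE !(rmorphD, rmorphM) /= -sx -ty.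
  by ring.
Qed.

Lemma localization_pm : pm_ring A -> pm_ring AS.
Proof.
move=> pmA P prP; have idP := prime_is_ideal prP.
have [M [maxM PM]] := ideal_sub_maximal idP (ideal_proper1 idP (prime_proper prP)).
exists M; split=> // N [maxN PN]; apply: contrapT => MN.
have [x [y [Mx Ny xy1]]] := maximal_comaximal maxM maxN MN.
have [a [s [s0 sx]]] := embed_fracP x.
have [b [t [t0 ty]]] := embed_fracP y.
(* Clearing denominators in [x + y = 1] gives [t * a + s * b = s * t], an element of empty locus. *)
have ab0 : psi a `&` psi b = set0.
  rewrite -subset0 -(semi_transitionMl hpsi a t0) -(semi_transitionMl hpsi b s0).
  have -> : set0 = psi (t * a + s * b).
    rewrite (_ : t * a + s * b = s * t) ?(semi_transitionMl hpsi) //.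
    apply: embed_inj; rewrite !(rmorphD, rmorphM) /= -sx -ty.
    by rewrite mulrCA !mulrA -mulrDr xy1 mulr1.
  exact: semi_transition_subD.
have [m [n [a' [b' [d [m0 n0 d0 [aE bE] uv]]]]]] := comaximal_cofactors hpsi ab0.
have [z zd] := embed_unit d0.
(* In the fractions [c'] is [c ^+ k] divided by the unit [d], hence in [L] as [k] is positive; so 1
   in the adjunction would put 1 in [L]. *)
have no L w c k c' : maximal_ideal L -> P `<=` L -> L w ->
    (exists r, iota c = r * w) -> (0 < k)%N -> c ^+ k = c' * d ->
    ~ adjoin (iota @^-1` P) c' 1.
  move=> maxL PL Lw [r cw] k0 cE [q [e [Pq q1]]].
  have idL := maximal_is_ideal maxL.
  apply: (ideal_proper1 idL (maximal_proper maxL)).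
  rewrite -[1](rmorph1 iota) q1 rmorphD rmorphM /=.
  apply: idealD => //; first exact: PL.
  have -> : iota c' = z * iota (c ^+ k).
    by rewrite cE rmorphM mulrCA zd mulr1.
  rewrite -(prednK k0) exprSr rmorphM /= cw !mulrA.
  exact: idealMl.
have [] := pm_ring_comaximal pmA (prime_preimage iota prP) uv.
- by apply: (no M x a m) => //; exists (iota s).
- by apply: (no N y b n) => //; exists (iota t).
Qed.

End Fractions.

(** Witnesses for (T1) and (T2) are images of those in [A], since [embed] preserves loci and each
    fraction has the locus of its numerator. *)
Lemma frac_transition (A : comPzRingType) (Lambda : Type)
    (psi : A -> set Lambda) (hpsi : transition psi) :
  transition (@frac_locus A Lambda psi (transition_semi hpsi)).
Proof.
split.
- exact/localization_pm/(transition_pm hpsi).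
- exact: frac_semi_transition.
- move=> l1 l2 /(transition_separates hpsi)[a al].
  by exists (embed _ a); rewrite frac_locus_embed.
- move=> l x; have [a [s [s0 sx]]] := embed_fracP x.
  rewrite (frac_locusE s0 sx) => /(transition_regular hpsi)[b bl].
  by exists (embed _ b); rewrite frac_locus_embed.
Qed.

Theorem theorem5p2 (A : comPzRingType) (Lambda : Type) (psi : A -> set Lambda)
    (hpsi : transition psi) :
  transitional (localization (empty_locus_mulrClosed (transition_semi hpsi))).
Proof.
have h := frac_transition hpsi.
split; first exact: transition_pm h.
by exists Lambda, (frac_locus (hpsi := transition_semi hpsi)).
Qed.
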